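(* Let $a \ge 1$ be an integer. For every integer $n \ge 1$, all integers $m \in \left[1, \sqrt{\frac{n}{a}}\right]$ belong to $\mathcal{Q}_a[1,n]$. In particular, $$|\mathcal{Q}_a^-(n)| \ge \left\lfloor \sqrt{\frac{n}{a}} \right\rfloor.$$ Additionally, $|\mathcal{Q}_a[1,n]| > \sqrt{\frac{n}{a}}$ if $n > 1$.
   Context: For positive integers $d, n$, one writes $d \preccurlyeq_1 n$ if $d = \lfloor n/k \rfloor$ for some positive integer $k$. For an integer $a \ge 1$, one writes $d \preccurlyeq_a n$ (''$d$ is an $a$-floor quotient of $n$'') if and only if $ad \preccurlyeq_1 an$, i.e. there is a positive integer $k$ with $ad = \lfloor an/k \rfloor$. Set $\mathcal{Q}_a[1,n] = \{d \in \mathbb{N}^+ : d \preccurlyeq_a n\}$ and $\mathcal{Q}_a^-(n) = \{d \in \mathcal{Q}_a[1,n] : d \le \sqrt{n}\}$. $|\cdot|$ denotes cardinality. *)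

(* Defs.v *)
From mathcomp Require Import all_boot all_order all_algebra finmap.
From mathcomp Require Import boolp classical_sets functions cardinality reals.

Set Implicit Arguments.
Unset Strict Implicit.
Unset Printing Implicit Defensive.

Import Order.TTheory GRing.Theory Num.Theory.

Local Open Scope classical_set_scope.
Local Open Scope ring_scope.

(* Euclidean division on [nat] is the floor of the quotient when [0 < k]. *)
Definition floor_quotient (d n : nat) : Prop :=
  exists2 k : nat, (0 < k)%N & d = (n %/ k)%N.

Definition afloor_quotient (a d n : nat) : Prop :=
  floor_quotient (a * d)%N (a * n)%N.

Definition afloor_quotients (a n : nat) : set nat :=
  [set d | (0 < d)%N /\ afloor_quotient a d n].

Definition afloor_quotients_minus (R : realType) (a n : nat) : set nat :=
  [set d | afloor_quotients a n d /\ d%:R <= Num.sqrt (n%:R : R)].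

(* [fset_set] is [fset0] on infinite sets; the two sets measured here are finite
   for [0 < a], see below. *)
Definition set_card (A : set nat) : nat := #|` fset_set A|%fset.

Lemma finite_afloor_quotients (a n : nat) : (0 < a)%N -> finite_set (afloor_quotients a n).
Proof.
move=> a0; apply: (@sub_finite_set _ _ `I_n.+1); last exact: finite_II.
move=> d [_ [k _ e]] /=; rewrite ltnS -(leq_pmul2l a0) e.
exact: leq_div.
Qed.

Lemma finite_afloor_quotients_minus (R : realType) (a n : nat) :
  (0 < a)%N -> finite_set (afloor_quotients_minus R a n).
Proof.
by move=> a0; apply: (sub_finite_set _ (finite_afloor_quotients n a0)) => d [].
Qed.

(* Main.v *)
Require Import Defs.
From mathcomp Require Import all_boot all_order all_algebra finmap.
From mathcomp Require Import boolp classical_sets functions cardinality reals.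

(** Let [m] be a positive integer with [a m ^ 2 <= n], which is what
    [m <= sqrt (n / a)] means, and let [k] be the integer quotient of [n] by [m].
    Then [k >= a m], and [n] exceeds [k m] by a remainder of at most [m - 1], so
    [a n] exceeds [k (a m)] by at most [a (m - 1) < a m <= k]: the quotient of
    [a n] by [k] is exactly [a m] ([afloor_quotient_small]).

    Both counts follow.  Let [r] be the integer part of [sqrt (n / a)].  The
    integers [1, ..., r] are [a]-floor quotients of [n], and they are at most
    [sqrt (n / a) <= sqrt n].  For [n > 1] one more is available, namely [n]
    itself, which is larger than [sqrt n] and therefore than [r]; this gives
    [r + 1 > sqrt (n / a)] of them. *)

Import Order.TTheory GRing.Theory Num.Theory.

Local Open Scope classical_set_scope.
Local Open Scope ring_scope.

(** The witness [k = n %/ m] works because the bound on [m] makes [k] at least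
    [a * m], hence larger than [a] times the remainder of [n] modulo [m]. *)
Lemma afloor_quotient_small (a m n : nat) :
  (0 < a)%N -> (0 < m)%N -> (a * m ^ 2 <= n)%N -> afloor_quotient a m n.
Proof.
move=> a_gt0 m_gt0 am2_le_n.
have le_am_k : (a * m <= n %/ m)%N by rewrite leq_divRL // -mulnA mulnn.
have k_gt0 : (0 < n %/ m)%N by rewrite (leq_trans _ le_am_k) ?muln_gt0 ?a_gt0.
exists (n %/ m)%N => //.
have -> : (a * n = a * m * (n %/ m) + a * (n %% m))%N.
  by rewrite {1}(divn_eq n m) mulnDr -mulnA [(m * _)%N]mulnC.
rewrite divnMDl // divn_small ?addn0 //.
by rewrite (leq_trans _ le_am_k) // ltn_pmul2l // ltn_mod.
Qed.

Lemma afloor_quotient_refl (a n : nat) : afloor_quotient a n n.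
Proof. by exists 1%N; rewrite ?divn1. Qed.

(** Finiteness matters: on an infinite set [set_card] takes the value [0]. *)
Lemma size_le_set_card (A : set nat) (s : seq nat) :
  finite_set A -> uniq s -> (forall x, x \in s -> A x) ->
  (size s <= set_card A)%N.
Proof.
move=> finA s_uniq sA; apply: uniq_leq_size => // x /sA Ax.
by rewrite in_fset_set // inE.
Qed.

(** Squaring both sides turns the bound by a real square root into the purely
    arithmetic hypothesis of [afloor_quotient_small]. *)
Lemma natr_le_sqrt_div (R : realType) (a m n : nat) : (0 < a)%N ->
  (m%:R <= Num.sqrt (n%:R / a%:R : R)) = (a * m ^ 2 <= n)%N.
Proof.
move=> a_gt0.
rewrite -[m%:R]ger0_norm // -sqrtr_sqr ler_sqrt ?divr_ge0 //.
by rewrite ler_pdivlMr ?ltr0n // -natrX -natrM ler_nat mulnC.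
Qed.

Lemma sqrt_div_le_sqrt (R : realType) (a n : nat) : (0 < a)%N ->
  Num.sqrt (n%:R / a%:R : R) <= Num.sqrt n%:R.
Proof.
by move=> a_gt0; rewrite ler_wsqrtr // ler_pdivrMr ?ltr0n // ler_peMr // ler1n.
Qed.

Theorem lemma5p2 (R : realType) (a n : nat) (ha : (1 <= a)%N) (hn : (1 <= n)%N) :
  [/\ forall m : nat,
        (1 <= m)%N -> m%:R <= Num.sqrt (n%:R / a%:R : R) -> afloor_quotients a n m,
      Num.floor (Num.sqrt (n%:R / a%:R : R)) <= (set_card (afloor_quotients_minus R a n))%:Z
    & (1 < n)%N -> Num.sqrt (n%:R / a%:R : R) < (set_card (afloor_quotients a n))%:R].
Proof.
set s := Num.sqrt _.
have small m : (1 <= m)%N -> m%:R <= s -> afloor_quotients a n m.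
  by move=> m_gt0; rewrite natr_le_sqrt_div // => am2_le_n;
     split=> //; exact: afloor_quotient_small.
pose r := Num.truncn s.
have /andP[r_le_s s_lt_r1] : r%:R <= s < r.+1%:R by rewrite truncn_itv ?sqrtr_ge0.
have in_iota m : m \in iota 1 r -> (1 <= m)%N /\ m%:R <= s.
  rewrite mem_iota add1n ltnS => /andP[m_gt0 m_le_r]; split=> //.
  by rewrite (le_trans _ r_le_s) // ler_nat.
split=> // [|n_gt1].
- have r_le_card : (r <= set_card (afloor_quotients_minus R a n))%N.
    rewrite -{1}(size_iota 1 r); apply: size_le_set_card.
    + exact: finite_afloor_quotients_minus.
    + exact: iota_uniq.
    + move=> m /in_iota[m_gt0 m_le_s]; split; first exact: small.
      exact: le_trans m_le_s (sqrt_div_le_sqrt R a n ha).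
  (* The bound on the floor amounts to a strict bound on [s] by [card + 1]. *)
  rewrite -ltzD1 floor_lt_int intrD (lt_le_trans s_lt_r1) //.
  by rewrite -natr1 lerD2r ler_nat.
- (* Otherwise [a * n ^ 2 <= n], which fails for [1 < n]. *)
  have n_notin : n \notin iota 1 r.
    apply/negP => /in_iota[_]; rewrite natr_le_sqrt_div // leqNgt => /negP; apply.
    by rewrite -mulnn (leq_trans (ltn_Pmulr n_gt1 hn)) ?leq_pmull.
  apply: (lt_le_trans s_lt_r1); rewrite ler_nat.
  rewrite -(size_iota 1 r) -[(size _).+1]/(size (n :: iota 1 r)).
  apply: size_le_set_card.
  + exact: finite_afloor_quotients.
  + by rewrite /= n_notin iota_uniq.
  + move=> m; rewrite inE => /orP[/eqP->|/in_iota[m_gt0 /small]]; last exact.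
    by split=> //; exact: afloor_quotient_refl.
Qed.
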